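(* Define finite words over $\{0,1\}$ inductively by $\omega_1=1$ and $\omega_{n+1}=\omega_n\,0^n\,\omega_n$ for $n\ge 1$, where $0^n$ denotes the word of $n$ consecutive zeros, and let $\ell_n$ be the length of $\omega_n$. Let $\xi\in\{0,1\}^{\mathbb{Z}}$ be the sequence with $\xi(n)=0$ for all $n<0$ and $\xi(0)\xi(1)\cdots\xi(\ell_n-1)=\omega_n$ for every $n\ge 1$. Let $T:\{0,1\}^{\mathbb{Z}}\to\{0,1\}^{\mathbb{Z}}$ be the left shift and let $X=\overline{\{T^n\xi:n\in\mathbb{Z}\}}$. Then $(X,T)$ is a topologically transitive subshift which is not minimal and is pointwise recurrent, i.e. every point of $X$ is recurrent for $T$.
   Context: $\{0,1\}^{\mathbb{Z}}$ carries the product topology and $(Tx)(n)=x(n+1)$. The sequence $\xi$ is well defined since each $\omega_n$ is a prefix of $\omega_{n+1}$. For a homeomorphism $f$ of a compact metric space $X$: a point $x$ is positively recurrent if there are $0<n_1<n_2<\cdots$ with $f^{n_i}(x)\to x$; negatively recurrent if there are $0<n_1<n_2<\cdots$ with $f^{-n_i}(x)\to x$; and recurrent if it is either positively recurrent or negatively recurrent. The map $f$ is topologically transitive if $X=\overline{\{f^n(x):n\in\mathbb{Z}\}}$ for some $x\in X$. The system $(X,f)$ is minimal if $\{f^n(x):n\in\mathbb{Z}\}$ is dense in $X$ for every $x\in X$. *)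

(* Defs.v *)
From HB Require Import structures.
From mathcomp Require Import all_boot all_order all_algebra.
From mathcomp Require Import all_classical topology function_spaces.
From mathcomp Require Import zify.

Set Implicit Arguments.
Unset Strict Implicit.
Unset Printing Implicit Defensive.

Import Order.TTheory GRing.Theory Num.Theory.
Local Open Scope classical_set_scope.
Local Open Scope ring_scope.

Record homeo (U : topologicalType) := Homeo {
  homeo_fun :> U -> U;
  homeo_inv : U -> U;
  homeo_funK : cancel homeo_fun homeo_inv;
  homeo_invK : cancel homeo_inv homeo_fun;
  homeo_fun_continuous : continuous homeo_fun;
  homeo_inv_continuous : continuous homeo_inv }.

Section Dynamics.
Context (U : topologicalType) (f : homeo U).

Definition homeo_iter (k : int) : U -> U :=
  match k with
  | Posz n => iter n f
  | Negz n => iter n.+1 (homeo_inv f)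
  end.

Definition homeo_orbit (x : U) : set U := [set homeo_iter k x | k in [set: int]].

Definition positively_recurrent (x : U) : Prop :=
  exists n : nat -> nat,
    [/\ (0 < n 0)%N, (forall i, (n i < n i.+1)%N) &
        (fun i => homeo_iter (n i)%:Z x) @ \oo --> x].

Definition negatively_recurrent (x : U) : Prop :=
  exists n : nat -> nat,
    [/\ (0 < n 0)%N, (forall i, (n i < n i.+1)%N) &
        (fun i => homeo_iter (- (n i)%:Z) x) @ \oo --> x].

Definition recurrent (x : U) : Prop :=
  positively_recurrent x \/ negatively_recurrent x.

(* A subsystem of (U, f) is given by its underlying closed subset X of U with
   f(X) = X.  As X is closed, the closure in X of an orbit contained in X is
   its closure in U, so the notions below, stated with closures in U, are
   those of the system (X, f|_X). *)
Definition subsystem (X : set U) : Prop := closed X /\ f @` X = X.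

Definition transitive_on (X : set U) : Prop :=
  exists2 x, X x & X = closure (homeo_orbit x).

Definition minimal_on (X : set U) : Prop :=
  forall x, X x -> X = closure (homeo_orbit x).

Definition pointwise_recurrent_on (X : set U) : Prop :=
  forall x, X x -> recurrent x.

End Dynamics.

(* {0,1}^Z with the product topology, bool being discrete; the letters 0 and 1
   are false and true. *)
Notation full_shift := (prod_topology (fun _ : int => bool)).

Definition translate (m : int) (x : full_shift) : full_shift :=
  fun k => x (k + m).

Lemma translateK m : cancel (translate m) (translate (- m)).
Proof. by move=> x; apply/funext => k; rewrite /translate subrK. Qed.

Lemma translateNK m : cancel (translate (- m)) (translate m).
Proof. by move=> x; apply/funext => k; rewrite /translate addrK. Qed.

Lemma translate_continuous m : continuous (translate m).
Proof.
move=> x; apply/cvg_sup => k A [_ [[C oC <-] Cxk] CA]; apply: filterS CA _.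
apply: (@proj_continuous int (fun=> bool) (k + m) x).
exact: open_nbhs_nbhs.
Qed.

Definition left_shift : homeo full_shift :=
  Homeo (translateK 1) (translateNK 1)
    (@translate_continuous 1) (@translate_continuous (- 1)).

(* Indexed from 1; the value at 0 is a dummy. *)
Fixpoint omega (n : nat) : seq bool :=
  if n is m.+1 then
    if m is 0%N then [:: true] else omega m ++ nseq m false ++ omega m
  else [::].

Lemma omegaS n : (0 < n)%N -> omega n.+1 = omega n ++ nseq n false ++ omega n.
Proof. by case: n. Qed.

Lemma leq_size_omega n : (n <= size (omega n))%N.
Proof.
elim: n => [//|[//|n] IHn]; rewrite omegaS // !size_cat size_nseq.
by move: IHn; lia.
Qed.

Lemma nth_omega m n k : (0 < m)%N -> (m <= n)%N -> (k < size (omega m))%N ->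
  nth false (omega n) k = nth false (omega m) k.
Proof.
move=> m0 + km; elim: n => [|n IHn]; first by rewrite leqn0; case: m m0 km.
rewrite leq_eqVlt => /predU1P[<- //|]; rewrite ltnS => mn.
have n0 : (0 < n)%N := leq_trans m0 mn.
rewrite omegaS // nth_cat; case: ltnP => [_|nk]; first exact: IHn.
have /(nth_default false) kn0 := nk.
suff: (size (omega m) <= size (omega n))%N by move: km nk; lia.
elim: (n) mn {IHn n0 nk kn0} => [|p IHp]; first by case: m m0 km.
rewrite leq_eqVlt => /predU1P[<- //|]; rewrite ltnS => mp.
by rewrite omegaS ?(leq_trans m0) // size_cat (leq_trans (IHp mp)) ?leq_addr.
Qed.

Lemma xi_well_defined : exists! xi : full_shift,
  (forall k : int, k < 0 -> xi k = false) /\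
  (forall n, (1 <= n)%N ->
    [seq xi i%:Z | i <- iota 0 (size (omega n))] = omega n).
Proof.
exists (fun k => if k is Posz n then nth false (omega n.+1) n else false).
split; first split.
- by case.
- move=> n n1; apply: (@eq_from_nth _ false); first by rewrite size_map size_iota.
  move=> i; rewrite size_map size_iota => si.
  rewrite (nth_map 0%N) ?size_iota // nth_iota // add0n.
  have [ni|ni] := leqP n i.+1; first exact: nth_omega.
  by rewrite -(@nth_omega i.+1 n) ?(ltnW ni) // leq_size_omega.
move=> y [y0 yw]; apply/funext => -[n|n]; last by rewrite y0.
rewrite -(yw n.+1 isT) (nth_map 0%N) ?size_iota ?leq_size_omega //.
by rewrite nth_iota ?leq_size_omega.
Qed.

(* Main.v *)
Require Import Defs.
From mathcomp Require Import all_boot all_order all_algebra.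
From mathcomp Require Import all_classical topology function_spaces.
From mathcomp Require Import zify.
Import Order.TTheory GRing.Theory Num.Theory.
Local Open Scope classical_set_scope.
Local Open Scope ring_scope.

(** Write l_n for the length of omega_n.  The heart of the proof is a uniform
    return property of xi: if xi has a 1 at p, then for every n >= 1 the window
    [p - n, p + n] of xi reappears, unchanged, at distance exactly l_n + n, to
    the right or to the left.  Indeed this 1 lies in one of the two copies of
    omega_n in a block 0^n omega_n 0^n omega_n 0^n of xi; both copies have n
    zeros on each side, so the shift by l_n + n towards the other copy matches
    them together with their margins (omega_return).

    The distance depends on n only, so the property is a condition on windows
    of bounded size, and it passes to every limit x of shifts of xi having a 1
    at some place p: any window [- N, N] of x sits inside [p - n, p + n] for
    n > N + |p|, and returns at a distance at least n.  The direction may vary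
    with N, but one of the two serves infinitely many N, and a return
    of a large window is a return of the smaller ones; so x is positively or
    negatively recurrent (recurrent_window).  The remaining point, the zero
    sequence, is fixed.  It belongs to X because xi vanishes on the negative
    integers, and its orbit closure misses xi, so X is not minimal. *)

Definition zero_ext (w : seq bool) (k : int) : bool :=
  if k is Posz n then nth false w n else false.

Lemma zero_ext_out w (k : int) : k < 0 \/ (size w)%:Z <= k ->
  zero_ext w k = false.
Proof. by case: k => // k kw; rewrite /zero_ext nth_default //; lia. Qed.

Lemma zero_ext_in w (k : int) : zero_ext w k -> 0 <= k < (size w)%:Z.
Proof.
move=> wk; apply/negPn/negP => kw; rewrite zero_ext_out // in wk.
by move: kw; lia.
Qed.

(** The prefix omega_m of omega_{m+1} is followed by m zeros, so agreement with
    the zero extension of omega_m goes on through this gap. *)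
Lemma zero_ext_omegaSl m (k : int) : (0 < m)%N ->
  k < (size (omega m))%:Z + m%:Z ->
  zero_ext (omega m.+1) k = zero_ext (omega m) k.
Proof.
case: k => // k m0 km; rewrite /zero_ext omegaS // !nth_cat size_nseq.
case: ltnP => // mk; rewrite (nth_default _ mk) nth_nseq.
have -> : (k - size (omega m) < m)%N by move: km; lia.
by [].
Qed.

(** The counterpart for the second copy of omega_m, which starts at l_m + m
    and has the same gap of m zeros on its left. *)
Lemma zero_ext_omegaSr m (k : int) : (0 < m)%N -> - m%:Z <= k ->
  zero_ext (omega m.+1) (k + ((size (omega m))%:Z + m%:Z)) =
  zero_ext (omega m) k.
Proof.
move=> m0; have [k0 mk|k0 _] := ltP k 0.
  by rewrite zero_ext_omegaSl //; [rewrite !zero_ext_out //; lia|lia].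
case: k k0 => // k _; rewrite -!PoszD /zero_ext omegaS // catA nth_cat.
rewrite size_cat size_nseq ifN; last by lia.
by congr nth; lia.
Qed.

(** Induction on m.  For m = n + 1 the two copies of omega_n match.
    Otherwise p lies in one of the two copies of omega_m, to which the
    induction hypothesis applies; since it gives a 1 at p + s too, p + s is in
    the same copy, so both windows of radius n < m stay within this copy and
    its gap, where omega_{m+1} and omega_m agree. *)
Lemma omega_return n m (p : int) : (0 < n)%N -> (n < m)%N ->
  zero_ext (omega m) p ->
  exists2 s : int, `|s|%N = (size (omega n) + n)%N &
    forall j : int, p - n%:Z <= j <= p + n%:Z ->
      zero_ext (omega m) (j + s) = zero_ext (omega m) j.
Proof.
move=> n0; elim: m p => // m IHm p; rewrite ltnS leq_eqVlt => nm.
have m0 : (0 < m)%N by case/predU1P: nm => [<- //|]; lia.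
set L : int := (size (omega m))%:Z + m%:Z => zp.
have [pL|Lp] := ltP p L.
  have {}zp : zero_ext (omega m) p by rewrite -zero_ext_omegaSl.
  have /andP[p0 pm] := zero_ext_in _ _ zp.
  (* p is in the first copy *)
  case/predU1P: nm => [nm|nm].
    exists L => [|j jp]; first by rewrite nm /L; lia.
    by rewrite zero_ext_omegaSr ?zero_ext_omegaSl //; lia.
  have [s sE zs] := IHm p nm zp; exists s => // j jp.
  have /zero_ext_in/andP[ps0 psm] : zero_ext (omega m) (p + s).
    by rewrite zs //; lia.
  by rewrite !zero_ext_omegaSl ?zs //; lia.
(* p is in the second copy, at the place q of omega_m *)
pose q : int := p - L; have qE : p = q + L by rewrite /q subrK.
have {}zp : zero_ext (omega m) q by rewrite -zero_ext_omegaSr -?qE //; lia.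
have /andP[q0 qm] := zero_ext_in _ _ zp.
case/predU1P: nm => [nm|nm].
  exists (- L) => [|j jp]; first by rewrite nm /L; lia.
  have -> : zero_ext (omega m.+1) j = zero_ext (omega m) (j - L).
    by rewrite -[in RHS]zero_ext_omegaSr ?subrK //; lia.
  by rewrite zero_ext_omegaSl //; lia.
have [s sE zs] := IHm q nm zp; exists s => // j jp.
have /zero_ext_in/andP[qs0 qsm] : zero_ext (omega m) (q + s).
  by rewrite zs //; lia.
have -> : j = j - L + L by rewrite subrK.
rewrite addrAC !zero_ext_omegaSr ?zs //; lia.
Qed.

Lemma homeo_iter_left_shift (k : int) (x : full_shift) (j : int) :
  homeo_iter left_shift k x j = x (j + k).
Proof.
case: k => n /=.
  elim: n j => [|n IHn] j; first by rewrite addr0.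
  by rewrite iterS /= /translate IHn; congr x; lia.
rewrite /translate.
have E (i : int) : iter n (translate (- 1)) x i = x (i - n%:Z).
  elim: n i => [|n IHn] i; first by rewrite subr0.
  by rewrite iterS /translate IHn; congr x; lia.
by rewrite E; congr x; lia.
Qed.

Lemma nbhs_window (x : full_shift) (N : nat) :
  nbhs x [set y : full_shift | forall j : int, (`|j| <= N)%N -> y j = x j].
Proof.
have nx (k : int) : nbhs x [set y : full_shift | y k = x k].
  apply: (@proj_continuous int (fun=> bool) k x [set x k]).
  by apply: open_nbhs_nbhs; split => //; exact: discrete_open.
elim: N => [|N IHN].
  by apply: filterS (nx 0) => y /= y0 j j0; have -> : j = 0 by lia.
apply: filterS (filterI IHN (filterI (nx N.+1%:Z) (nx (- N.+1%:Z)))).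
move=> y [yN [y1 y2]] j jN.
have [/yN //|Nj] := leqP `|j|%N N.
by have [->|->] : j = N.+1%:Z \/ j = - N.+1%:Z by lia.
Qed.

Lemma cvg_window (u : nat -> full_shift) (x : full_shift) :
  (forall i (j : int), (`|j| <= i)%N -> u i j = x j) -> u @ \oo --> x.
Proof.
move=> ux; apply/cvg_sup => k A [_ [[C oC <-] Cxk] CA]; apply: filterS CA _.
exists `|k|%N => // i /= ki; rewrite /= /proj /=.
by rewrite ux.
Qed.

(** The map g is the inclusion of the naturals for positive recurrence and its
    opposite for negative recurrence.  Iterating a choice m = f N of a return
    time makes n_i = f^{i+1}(0) strictly increasing, and time n_i restores
    the window of radius f^i(0) >= i. *)
Lemma return_times (g : nat -> int) (x : full_shift) :
  (forall N, exists m, (N < m)%N /\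
    forall j : int, (`|j| <= N)%N -> x (j + g m) = x j) ->
  exists n : nat -> nat,
    [/\ (0 < n 0)%N, (forall i, (n i < n i.+1)%N) &
        (fun i => homeo_iter left_shift (g (n i)) x) @ \oo --> x].
Proof.
move=> /choice[f fP].
have le_iter i : (i <= iter i f 0)%N.
  by elim: i => // i IHi; rewrite iterS (leq_ltn_trans IHi) ?(fP _).1.
exists (fun i => iter i.+1 f 0%N); split => [|i|].
- exact: (fP 0%N).1.
- exact: (fP _).1.
apply: cvg_window => i j ji; rewrite homeo_iter_left_shift.
by apply: (fP _).2; rewrite (leq_trans ji).
Qed.

(** If forward returns fail for some radius N0, they fail for all larger radii,
    so that all windows of radius at least N0 return backwards. *)
Lemma recurrent_window (x : full_shift) :
  (forall N, exists2 s : int, (N < `|s|)%N &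
    forall j : int, (`|j| <= N)%N -> x (j + s) = x j) ->
  recurrent left_shift x.
Proof.
move=> H; have [pos|/existsNP[N0 neg]] := pselect (forall N, exists m,
    (N < m)%N /\ forall j : int, (`|j| <= N)%N -> x (j + m%:Z) = x j).
  by left; exact: return_times.
right; apply: (@return_times (fun m => - m%:Z)) => N.
have [s sN xs] := H (maxn N N0); exists `|s|%N; split; first by lia.
move=> j jN; case: (leP 0 s) => s0; last first.
  by rewrite (_ : - `|s|%N%:Z = s) ?xs //; lia.
case: neg; exists `|s|%N; split; first by lia.
by move=> i iN; rewrite (_ : `|s|%N%:Z = s) ?xs //; lia.
Qed.

(** Windows of finite radius form a basis of neighbourhoods of a point. *)
Lemma closure_orbit_window (x y : full_shift) :
  closure (homeo_orbit left_shift x) y <->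
  forall N, exists k : int, forall j : int, (`|j| <= N)%N -> y j = x (j + k).
Proof.
split=> [xy N|/choice[k kP]].
  have [_ [[k _ <-] yN]] := xy _ (nbhs_window y N).
  by exists k => j /yN <-; rewrite homeo_iter_left_shift.
pose u i := homeo_iter left_shift (k i) x.
apply: (@closed_cvg _ _ \oo _ u (closure (homeo_orbit left_shift x))).
- exact: closed_closure.
- by apply: nearW => i; apply: subset_closure; exists (k i).
by apply: cvg_window => i j ji; rewrite /u homeo_iter_left_shift -kP.
Qed.

Lemma subsystem_closure_orbit (x : full_shift) :
  subsystem left_shift (closure (homeo_orbit left_shift x)).
Proof.
have inv (d : int) y : `|d|%N = 1%N ->
    closure (homeo_orbit left_shift x) y ->
    closure (homeo_orbit left_shift x) (translate d y).
  move=> d1 /closure_orbit_window xy; apply/closure_orbit_window => N.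
  have [k yk] := xy N.+1; exists (k + d) => j jN.
  rewrite /translate yk; last by lia.
  by rewrite addrAC addrA.
split; first exact: closed_closure.
apply/seteqP; split=> [_ [y xy <-]|y xy]; first exact: inv.
by exists (translate (- 1) y); [exact: inv|exact: translateNK].
Qed.

Theorem mainTheorem4 (xi : full_shift)
    (xi_neg : forall k : int, k < 0 -> xi k = false)
    (xi_omega : forall n : nat, (1 <= n)%N ->
      [seq xi i%:Z | i <- iota 0 (size (omega n))] = omega n) :
  let X := closure (homeo_orbit left_shift xi) in
  [/\ subsystem left_shift X,
      transitive_on left_shift X,
      ~ minimal_on left_shift X &
      pointwise_recurrent_on left_shift X].
Proof.
move=> X.
have xiE m (k : int) : (0 < m)%N -> k < (size (omega m))%:Z ->
    xi k = zero_ext (omega m) k.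
  case: k => [k|k] m0 km; last by rewrite xi_neg.
  by rewrite /= -xi_omega // (nth_map 0%N) ?size_iota ?nth_iota //; lia.
have Xxi : X xi.
  by apply/closure_orbit_window => N; exists 0 => j _; rewrite addr0.
split.
- exact: subsystem_closure_orbit.
- by exists xi.
- pose zero : full_shift := fun=> false.
  have X0 : X zero.
    apply/closure_orbit_window => N; exists (- N.+1%:Z) => j jN.
    by rewrite xi_neg //; lia.
  move=> /(_ _ X0) XE; move: Xxi; rewrite XE => /closure_orbit_window.
  (* xi is 1 at the origin, unlike all shifts of the zero sequence *)
  move=> /(_ 0%N)[k /(_ 0 isT)].
  by rewrite (@xiE 1%N).
move=> x /closure_orbit_window xX; apply: recurrent_window => N.
have [[p xp]|x0] := pselect (exists p, x p); last first.
  have x0E j : x j = false by apply/negP => xj; apply: x0; exists j.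
  by exists N.+1%:Z => // j _; rewrite !x0E.
pose n := (N + `|p|).+1; pose c := (size (omega n) + n)%N.
(* The radius n + c covers p, the window of radius N, and its translates by
   distance c; omega_m is long enough to hold p + k and the same windows. *)
have [k xk] := xX (n + c)%N.
pose m := (`|p + k| + n + c).+1.
have le_m := leq_size_omega m.
have zp : zero_ext (omega m) (p + k).
  by rewrite -xiE -?xk //; lia.
have [||s sE zs] := @omega_return n m _ _ _ zp; [lia..|].
exists s => [|j jN]; first by lia.
rewrite !xk; [|lia..].
by rewrite !(@xiE m) 1?addrAC ?zs //; lia.
Qed.
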